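(* There are absolute constants $C,K>0$ such that the following hold. (1) For all integers $p\ge q\ge2$ and $s\ge1$, $$\mathrm{HD}_1^{(s)}(p,q)\le K\,p\,s^{q/(q-1)}.$$ (2) For all integers $p>q\ge2$ and $s\ge1$ with $q\ge C\log(esp)$, $$\mathrm{HD}_1^{(s)}(p,q)\le p-q+1+K\, s\cdot\frac{p}{q}\cdot\log\frac{esp}{q}.$$
   Context: A set in $\mathbb{R}$ is called $s$-convex (an $s$-interval) if it is the union of at most $s$ convex sets (intervals); since only finite families are considered, one may equivalently take the intervals to be compact. For positive integers $p\ge q$, a family $\mathcal F$ of (distinct) sets with at least $p$ members satisfies the $(p,q)$-property if among every $p$ members of $\mathcal F$ some $q$ have a nonempty common intersection. A transversal (piercing set) of $\mathcal F$ is a set of points meeting every member of $\mathcal F$, and $\tau(\mathcal F)$ is the minimum size of a transversal. For $p\ge q\ge 2$, $\mathrm{HD}_1^{(s)}(p,q)$ denotes the least integer $N$ such that $\tau(\mathcal F)\le N$ for every finite family $\mathcal F$ of nonempty $s$-convex sets in $\mathbb{R}$ satisfying the $(p,q)$-property. Here $e$ is the base of the natural logarithm $\log$. *)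

(* Defs.v *)
From HB Require Import structures.
From mathcomp Require Import all_boot all_order all_algebra finmap.
From mathcomp Require Import all_classical all_reals all_analysis.

Set Implicit Arguments.
Unset Strict Implicit.
Unset Printing Implicit Defensive.

Import Order.TTheory GRing.Theory Num.Theory.
Local Open Scope classical_set_scope.
Local Open Scope ring_scope.

Definition s_convex (R : realType) (s : nat) (A : set R) : Prop :=
  exists2 t : nat, (t <= s)%N &
    exists2 J : 'I_t -> set R,
      forall i, is_interval (J i) & A = \bigcup_(i in [set: 'I_t]) J i.

Definition pq_property (R : realType) (p q : nat) (F : {fset set R}) : Prop :=
  (p <= #|` F|)%N /\
  forall G : {fset set R}, (G `<=` F)%fset -> #|` G| = p ->
    exists H : {fset set R}, [/\ (H `<=` G)%fset, #|` H| = q &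
      \bigcap_(A in [set` H]) A !=set0].

Definition piercing_set (R : realType) (F : {fset set R}) (P : {fset R}) : Prop :=
  forall A, A \in F -> ([set` P] `&` A !=set0)%classic.

Definition is_least (S : set nat) (n : nat) : Prop :=
  S n /\ forall m, S m -> (n <= m)%N.

Definition piercing_sizes (R : realType) (F : {fset set R}) : set nat :=
  [set #|` P| | P in [set P : {fset R} | piercing_set F P]].

(* Only meaningful when every member of [F] is nonempty, see [tauP]; otherwise
   no piercing set exists and the value is the default 0. *)
Definition tau (R : realType) (F : {fset set R}) : nat :=
  xget 0%N [set n | is_least (piercing_sizes F) n].

Lemma is_least_ex (S : set nat) : S !=set0 -> exists n, is_least S n.
Proof.
move=> [n0 Sn0].
have ex : exists n, `[< S n >] by exists n0; apply/asboolP.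
case: (ex_minnP ex) => n /asboolP Sn nmin.
by exists n; split=> // m Sm; apply: nmin; apply/asboolP.
Qed.

Lemma tauP (R : realType) (F : {fset set R}) :
  (forall A, A \in F -> A !=set0) -> is_least (piercing_sizes F) (tau F).
Proof.
move=> F0; rewrite /tau; apply: (@xgetPex _ 0%N [set n | is_least (piercing_sizes F) n]).
apply: is_least_ex.
pose P : {fset R} := [fset xget 0 A | A in F]%fset.
exists #|` P|; exists P => // A AF; exists (xget 0 A); split.
  by apply/imfsetP; exists A.
exact: (@xgetPex _ 0 A (F0 _ AF)).
Qed.

Definition HD_bound (R : realType) (s p q N : nat) : Prop :=
  forall F : {fset set R},
    (forall A, A \in F -> A !=set0 /\ s_convex s A) ->
    pq_property p q F -> (tau F <= N)%N.

(* The graph of HD_1^(s)(p,q) = N.  A relation is used rather than a function so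
   that the existence of a least bound is not hidden in a default value. *)
Definition is_HD (R : realType) (s p q N : nat) : Prop :=
  is_least [set M | HD_bound R s p q M] N.

(* Main.v *)
Require Import Defs.
From mathcomp Require Import all_boot all_order all_algebra finmap.
From mathcomp Require Import zify lra ring.
From mathcomp Require Import reals sequences.
From mathcomp.analysis Require Import exp.

(* Both bounds come from one fractional estimate.  Give the members weights in
   [0, 1] of total 2p and suppose every point has depth at most k.  An
   intersecting q-subset contains a common point that is the left end of a
   component of one of its members, so the intersecting q-subsets have total
   weight at most 2ps (e k / (q - 1)) ^ (q - 1).  If this is at most p, random
   sampling followed by deletion produces p members no q of which intersect.
   Hence some point has depth more than k.

   Since the weights are capped at 1, a potential argument replaces LP duality:
   a tuple of points minimising a quadratic potential hits all but 4p members
   with frequency of order k / p, and a member hit that often has a component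
   carrying a 1/s share of the hits, so about 8ps / k equally spaced points of
   the tuple pierce all these members.

   For (1) the 4p exceptional members are pierced one by one.  For (2), k is of
   order q; points of depth at least q among the exceptional members are removed
   greedily (at most 4p/q of them).  If d < q is the depth of what remains, it
   has at most p - q + d members by the (p, q)-property, and a deepest point
   together with one point for each other member makes p - q + 1 points. *)

Set Implicit Arguments.
Unset Strict Implicit.
Unset Printing Implicit Defensive.

Import Order.TTheory GRing.Theory Num.Theory.

(** * Finite model: families of unions of [s] intervals in ['I_N] *)

Definition ord_convex (N : nat) (J : {set 'I_N}) : Prop :=
  forall a b c : 'I_N, a \in J -> c \in J -> a <= b -> b <= c -> b \in J.

Definition hits (I : finType) (T N : nat) (A : I -> {set 'I_N})
    (t : {ffun 'I_T -> 'I_N}) (i : I) : nat := #|[set j | t j \in A i]|.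

Definition pierces (I : finType) (N : nat) (A : I -> {set 'I_N})
    (P : {set 'I_N}) (i : I) : bool := ~~ [disjoint P & A i].

Definition abstract_pq (I : finType) (N : nat) (A : I -> {set 'I_N})
    (p q : nat) : Prop :=
  p <= #|I| /\ forall S : {set I}, #|S| = p -> exists2 Q : {set I},
    Q \subset S /\ #|Q| = q & exists x, forall i, i \in Q -> x \in A i.

(** Left ends are minima; [x0] is only the value given to empty components, hence the conclusion
    refers to a member [y]. *)
Lemma left_ends (I : finType) (N s : nat) (J : I -> 'I_s -> {set 'I_N})
    (x0 : 'I_N) :
  exists l : I -> 'I_s -> 'I_N, forall i j (y : 'I_N), y \in J i j ->
    l i j \in J i j /\ l i j <= y.
Proof.
exists (fun i j => if [pick y in J i j] is Some y0
   then [arg min_(y < y0 in J i j) (y : nat)] else x0) => i j y yJ.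
case: pickP => [y0 y0J|/(_ y)]; last by rewrite yJ.
by case: arg_minnP => // z zJ zmin; split=> //; apply: zmin.
Qed.

(* Every common point can be pushed left until it becomes the left end of a
   component of one of the members. *)
Lemma common_left_end (I : finType) (N s : nat) (J : I -> 'I_s -> {set 'I_N})
    (l : I -> 'I_s -> 'I_N) (Q : {set I}) (x : 'I_N) (i0 : I) :
  (forall i j, ord_convex (J i j)) ->
  (forall i j (y : 'I_N), y \in J i j -> l i j \in J i j /\ l i j <= y) ->
  i0 \in Q -> (forall i, i \in Q -> x \in \bigcup_j J i j) ->
  exists i j, i \in Q /\ forall i', i' \in Q -> l i j \in \bigcup_k J i' k.
Proof.
move=> Jc lP i0Q xQ.
have [j0 _ _] := bigcupP (xQ _ i0Q).
pose c i := odflt j0 [pick j | x \in J i j].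
have cP i : i \in Q -> x \in J i (c i).
  move=> /xQ /bigcupP[j _ xJ]; rewrite /c.
  by case: pickP => [//|/(_ j)]; rewrite xJ.
(* The rightmost of these left ends is still at most [x], so it lies between the left end of every
   chosen component and [x], and convexity applies. *)
pose i := [arg max_(i > i0 in Q) (l i (c i) : nat)].
have [iQ imax] : i \in Q /\ forall i', i' \in Q -> l i' (c i') <= l i (c i).
  by rewrite /i; case: arg_maxnP.
exists i, (c i); split=> // i' i'Q; apply/bigcupP; exists (c i') => //.
have [lJ lx] := lP _ _ _ (cP _ i'Q).
apply: (Jc _ _ _ _ _ lJ (cP _ i'Q) (imax _ i'Q)).
by have [] := lP _ _ _ (cP _ iQ).
Qed.

(** * Tuples minimising a quadratic potential *)

(** The deficit [H - h] is the discrete derivative of this potential, also for [h >= H], where all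
    terms vanish. *)
Lemma binomial_potential (H h : nat) :
  'C((H - h).+1, 2) = 'C((H - h.+1).+1, 2) + (H - h).
Proof.
case: (ltnP h H) => [hH|Hh]; last first.
  have /eqP -> : H - h == 0 by rewrite subn_eq0.
  have /eqP -> : H - h.+1 == 0 by rewrite subn_eq0 leqW.
  by rewrite addn0.
rewrite subnSK //.
by rewrite binS bin1 addnC.
Qed.

Lemma hits_subst (I : finType) (T N : nat) (A : I -> {set 'I_N})
    (t : {ffun 'I_T -> 'I_N}) (j : 'I_T) (x : 'I_N) (i : I) :
  hits A [ffun k => if k == j then x else t k] i + (t j \in A i)
  = hits A t i + (x \in A i).
Proof.
rewrite /hits (cardsD1 j) [in RHS](cardsD1 j) !inE ffunE eqxx.
rewrite addnAC [in RHS]addnAC [(_ \in _) + (_ \in _)]addnC; congr (_ + _).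
by apply: eq_card => k; rewrite !inE ffunE; case: eqP.
Qed.

(* First-order optimality of a tuple minimising the potential: no single entry
   can profitably be replaced by [x]. *)
Lemma balanced_tuple (I : finType) (T N H : nat) (A : I -> {set 'I_N})
    (x0 : 'I_N) :
  exists t : {ffun 'I_T -> 'I_N}, forall x : 'I_N,
    T * \sum_(i | x \in A i) (H - hits A t i)
    <= H * \sum_i (H - hits A t i) + #|I| * H.
Proof.
have [psi psiS] : exists psi, forall h, psi h = psi h.+1 + (H - h).
  by exists (fun h => 'C((H - h).+1, 2)) => h; apply: binomial_potential.
pose Phi (t : {ffun 'I_T -> 'I_N}) := \sum_i psi (hits A t i).
exists [arg min_(t < ([ffun=> x0] : {ffun 'I_T -> 'I_N})) Phi t].
case: arg_minnP => // t _ tmin x.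
set h := hits A t.
(* Replacing [t j] by [x] gains [H - h i] where only [x] hits and costs [H - (h i).-1] where only
   [t j] did. Where both hit, nothing changes and the gain term is at most the cost term. *)
have step j : \sum_(i | x \in A i) (H - h i)
    <= \sum_i (t j \in A i) * (H - (h i).-1).
  have := tmin [ffun k => if k == j then x else t k] isT.
  set t' := [ffun _ => _]; rewrite /Phi => le_tt'.
  rewrite big_mkcond /= -(leq_add2l (\sum_i psi (hits A t' i))).
  apply: leq_trans (leq_add le_tt' (leqnn _)); rewrite -!big_split /=.
  apply: leq_sum => i _; have := hits_subst A t j x i; rewrite -/t' -/h.
  have : (t j \in A i) <= h i.
    case: (boolP (t j \in A i)) => // tj.
    by rewrite /h /hits card_gt0; apply/set0Pn; exists j; rewrite inE.
  move: (hits A t' i) => h'; move: (psiS (h i)) (psiS (h i).-1).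
  move: (h i) => u.
  case: (x \in A i); case: (t j \in A i) => /= e1 e2 u0 e3; rewrite ?mul1n ?mul0n.
  - have -> : h' = u by lia.
    lia.
  - have -> : h' = u.+1 by lia.
    lia.
  - have -> : h' = u.-1 by lia.
    by rewrite prednK // in e2; lia.
  - have -> : h' = u by lia.
    lia.
have -> : T * \sum_(i | x \in A i) (H - h i)
    = \sum_(j < T) \sum_(i | x \in A i) (H - h i).
  by rewrite sum_nat_const card_ord.
apply: (@leq_trans (\sum_(j < T) \sum_i (t j \in A i) * (H - (h i).-1))).
  by apply: leq_sum => j _; apply: step.
rewrite exchange_big /= big_distrr /= -[#|I| * H]sum_nat_const -big_split /=.
apply: leq_sum => i _.
rewrite -big_distrl /=; have -> : \sum_(j < T) (t j \in A i) = h i.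
  rewrite /h /hits -sum1dep_card [RHS]big_mkcond /=.
  by apply: eq_bigr => j _; case: ifP.
(* The shift from [h i] to [(h i).-1] costs at most [H] per member, whence the error term
   [#|I| * H]. *)
case: (leqP (h i) H) => hH; nia.
Qed.

(** * Piercing frequently hit members by a net *)

(** The net takes each point at which the number of entries seen so far passes a multiple of [m]. An
    interval holding [m] entries must contain such a passage. *)
Lemma equispaced_net (T N m : nat) (t : 'I_T -> 'I_N) : 0 < m ->
  exists2 P : {set 'I_N}, #|P| <= T %/ m &
    forall J : {set 'I_N}, ord_convex J -> m <= #|[set j | t j \in J]| ->
      ~~ [disjoint P & J].
Proof.
move=> m0; pose g n := #|[set j | t j < n]|.
have gmono a b : a <= b -> g a <= g b.
  by move=> ab; apply/subset_leq_card/subsetP => j; rewrite !inE => /leq_trans; apply.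
exists [set x : 'I_N | g x %/ m < g x.+1 %/ m].
  apply: (@leq_trans (\sum_(x < N) (g x.+1 %/ m - g x %/ m))).
    rewrite -sum1dep_card big_mkcond /=; apply: leq_sum => x _.
    by case: ifP => // H; rewrite subn_gt0.
  rewrite -(big_mkord predT (fun x => g x.+1 %/ m - g x %/ m)) /=.
  rewrite (@telescope_sumn _ _ (fun x => g x %/ m)); last first.
    by move=> a b ?; apply/leq_div2r/gmono.
  apply: (leq_trans (leq_subr _ _)); apply: leq_div2r.
  by apply: leq_trans (max_card _) _; rewrite card_ord.
move=> J Jc hJ.
have [j0 j0J] : exists j, t j \in J.
  have : 0 < #|[set j | t j \in J]| by apply: leq_trans hJ.
  by rewrite card_gt0 => /set0Pn[j]; rewrite inE; exists j.
have [a aJ amin] : exists2 a, a \in J & forall y : 'I_N, y \in J -> a <= y.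
  by exists [arg min_(y < t j0 in J) (y : nat)]; case: arg_minnP.
have [b bJ bmax] : exists2 b, b \in J & forall y : 'I_N, y \in J -> y <= b.
  by exists [arg max_(y > t j0 in J) (y : nat)]; case: arg_maxnP.
have gab : g a + m <= g b.+1.
  apply: leq_trans (leq_add (leqnn _) hJ) _; rewrite /g -cardsUI.
  rewrite [X in _ + X](_ : _ = 0) ?addn0; last first.
    apply/eqP; rewrite cards_eq0; apply/eqP/setP => j; rewrite !inE.
    by case: (boolP (t j \in J)) => [/amin|_]; rewrite ?andbF // andbT ltnNge => ->.
  apply/subset_leq_card/subsetP => j; rewrite !inE.
  case/orP => [ja|/bmax //]; apply: (leq_trans ja).
  by apply: leq_trans (amin _ bJ) _.
(* Discrete intermediate value argument: if the quotient rises over a range, it rises at a single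
   step of that range. *)
have jump n : a <= n -> n <= b -> g a %/ m < g n.+1 %/ m ->
    exists x : 'I_N, [/\ a <= x, x <= b & g x %/ m < g x.+1 %/ m].
  elim: n => [|n IH] an nb lt.
    have a0 : (a : nat) = 0 by lia.
    by exists a; split; rewrite ?leqnn ?amin //; move: lt; rewrite a0.
  have nN : n.+1 < N by apply: leq_ltn_trans nb (ltn_ord b).
  case: (ltnP (g n.+1 %/ m) (g n.+2 %/ m)) => [jmp|le].
    by exists (Ordinal nN).
  case: (ltnP n a) => na; last by apply: IH => //; lia.
  have e : (a : nat) = n.+1 by lia.
  by move: lt; rewrite e ltnNge le.
have [|x [ax xb jx]] := jump b (amin _ bJ) (leqnn _).
  apply: (@leq_trans ((g a + m) %/ m)); last exact: leq_div2r.
  by rewrite divnDr // divnn m0 addn1.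
apply/pred0Pn; exists x; rewrite /= inE jx /=; exact: Jc aJ bJ ax xb.
Qed.

(** Pigeonhole: of more than [s * m] hits, some component receives at least [m]. *)
Lemma net_of_tuple (I : finType) (T N s m : nat) (J : I -> 'I_s -> {set 'I_N})
    (A : I -> {set 'I_N}) (t : {ffun 'I_T -> 'I_N}) : 0 < m ->
  (forall i, A i = \bigcup_j J i j) -> (forall i j, ord_convex (J i j)) ->
  exists2 P : {set 'I_N}, #|P| <= T %/ m &
    forall i, s * m < hits A t i -> pierces A P i.
Proof.
move=> m0 AJ Jc; have [P sP PJ] := equispaced_net t m0; exists P => // i hi.
have [j mj] : exists j, m <= #|[set k | t k \in J i j]|.
  apply/existsP; apply: contraLR hi; rewrite negb_exists -leqNgt => /forallP small.
  rewrite /hits AJ.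
  have -> : [set k | t k \in \bigcup_j J i j] = \bigcup_j [set k | t k \in J i j].
    apply/setP => k; rewrite inE; apply/bigcupP/bigcupP.
      by move=> [j _ H]; exists j => //; rewrite inE.
    by move=> [j _]; rewrite inE => H; exists j.
  have -> : s * m = \sum_(j < s) m by rewrite sum_nat_const card_ord.
  apply: (@leq_trans (\sum_j #|[set k | t k \in J i j]|)).
    elim/big_rec2: _ => [|j n B _ le]; first by rewrite cards0.
    apply: leq_trans (leq_card_setU _ _).1 _; exact: leq_add.
  by apply: leq_sum => j _; have := small j; rewrite -ltnNge => /ltnW.
have := PJ _ (Jc i j) mj => /pred0Pn[x /= /andP[xP xJ]].
apply/pred0Pn; exists x; rewrite /= xP AJ /=; apply/bigcupP; by exists j.
Qed.

Local Open Scope ring_scope.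

(** * Random sampling with deletion *)

(** This is the probability that a random set contains [Q]. Expanding the product of
    [w i + (1 - w i)], with the second summand replaced by 0 on [Q], leaves exactly the sets above
    [Q]. *)
Lemma sum_prod_subsets (R : comNzRingType) (I : finType) (Q : {set I})
    (w : I -> R) :
  \sum_(S : {set I} | Q \subset S)
     (\prod_(i in S) w i * \prod_(i in ~: S) (1 - w i)) = \prod_(i in Q) w i.
Proof.
have -> : \prod_(i in Q) w i
    = \prod_i (w i + (if i \in Q then 0 else 1 - w i)).
  rewrite big_mkcond; apply: eq_bigr => i _; case: ifP => _; first by rewrite addr0.
  by rewrite addrC subrK.
rewrite bigA_distr [RHS](bigID (fun S : {set I} => Q \subset S)) /=.
rewrite [X in _ = _ + X]big1 ?addr0 => [|S /subsetPn[i iQ iS]]; last first.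
  by rewrite (bigD1 i) //= (negbTE iS) iQ mul0r.
apply: eq_big => [S //|S QS].
rewrite [X in X * _]big_mkcond [X in _ * X]big_mkcond -big_split /=.
apply: eq_bigr => i _; rewrite inE; case: ifP => iS /=; first by rewrite mulr1.
by rewrite mul1r; case: ifP => // /(subsetP QS); rewrite iS.
Qed.

(* First moment: include each [i] independently with probability [w i]. *)
Lemma exists_sample (R : realDomainType) (I : finType) (w : I -> R)
    (E : {set {set I}}) (p : nat) :
  (forall i, 0 <= w i <= 1) ->
  p%:R + \sum_(Q in E) \prod_(i in Q) w i <= \sum_i w i ->
  exists S : {set I}, (p + #|[set Q in E | Q \subset S]| <= #|S|)%N.
Proof.
move=> w01 hp.
pose P (S : {set I}) := \prod_(i in S) w i * \prod_(i in ~: S) (1 - w i).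
have P0 S : 0 <= P S.
  by apply: mulr_ge0; apply: prodr_ge0 => i _; rewrite ?subr_ge0; have /andP[] := w01 i.
have P1 : \sum_S P S = 1.
  have := sum_prod_subsets set0 w; rewrite big_set0 => <-.
  by apply: eq_bigl => S; rewrite sub0set.
have ES : \sum_i w i = \sum_S P S * #|S|%:R.
  transitivity (\sum_i \sum_(S : {set I} | i \in S) P S).
    apply: eq_bigr => i _; have := sum_prod_subsets [set i] w.
    by rewrite big_set1 => <-; apply: eq_bigl => S; rewrite sub1set.
  rewrite (exchange_big_dep predT) //=; apply: eq_bigr => S _.
  by rewrite sumr_const mulr_natr.
have EE : \sum_(Q in E) \prod_(i in Q) w i
    = \sum_S P S * #|[set Q in E | Q \subset S]|%:R.
  under eq_bigr => Q _ do rewrite -sum_prod_subsets.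
  rewrite (exchange_big_dep predT) //=; apply: eq_bigr => S _.
  by rewrite sumr_const mulr_natr cardsE.
apply/existsP; apply: contraLR hp; rewrite negb_exists => /forallP small.
have -> : p%:R = \sum_S P S * p%:R :> R by rewrite -mulr_suml P1 mul1r.
rewrite -ltNge ES EE -big_split /=.
(* A set of positive probability makes the averaged inequality strict. *)
have [S PS] : exists S, 0 < P S.
  apply/existsP; apply: contraT; rewrite negb_exists => /forallP P_le0.
  have : \sum_S P S <= 0 by apply: sumr_le0 => S _; rewrite leNgt.
  by rewrite P1 ler10.
rewrite (bigD1 S) //= [X in _ < X](bigD1 S) //=; apply: ltr_leD.
  by rewrite -mulrDr ltr_pM2l // -natrD ltr_nat ltnNge.
apply: ler_sum => S' _; rewrite -mulrDr ler_wpM2l // -natrD ler_nat ltnW //.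
by rewrite ltnNge.
Qed.

(** Removing one representative of each edge inside [S] destroys all of them and costs at most one
    element per edge. *)
Lemma delete_edges (I : finType) (E : {set {set I}}) (S : {set I}) (p : nat) :
  set0 \notin E -> (p + #|[set Q in E | Q \subset S]| <= #|S|)%N ->
  exists2 S' : {set I}, #|S'| = p & forall Q, Q \in E -> ~~ (Q \subset S').
Proof.
move=> E0 hS; pose D := [set Q in E | Q \subset S].
have [i0 i0S|S0] := pickP (mem S); last first.
  exists set0.
    rewrite cards0; apply/esym/eqP; rewrite -leqn0.
    by apply: leq_trans (leq_trans (leq_addr _ _) hS) _; rewrite (eq_card0 S0).
  by move=> Q QE; rewrite subset0; apply: contraNneq E0 => <-.
pose r (Q : {set I}) := odflt i0 [pick i in Q].
have [S' S'sub S'p] : exists2 S' : {set I}, S' \subset S :\: r @: D & #|S'| = p.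
  have : (p <= #|S :\: r @: D|)%N.
    rewrite -(leq_add2l #|S :&: r @: D|) cardsID addnC.
    apply: leq_trans hS; rewrite leq_add2l.
    exact: leq_trans (subset_leq_card (subsetIr _ _)) (leq_imset_card _ _).
  move=> /card_geqP [s [us <- sS]]; exists [set i in s].
    by apply/subsetP => i; rewrite inE => /sS.
  by rewrite cardsE; apply/card_uniqP.
exists S' => // Q QE; apply/negP => QS'.
have QS : Q \subset S :\: r @: D := subset_trans QS' S'sub.
have QD : Q \in D by rewrite inE QE (subset_trans QS) ?subsetDl.
have rQ : r Q \in Q.
  rewrite /r; case: pickP => //= Q0; case/negP: E0; suff <- : Q = set0 by [].
  by apply/setP => i; rewrite inE; have := Q0 i.
by have := subsetP QS _ rQ; rewrite inE imset_f.
Qed.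

(** * Total weight of the intersecting subsets *)

(* Chernoff-style estimate: [x ^+ m] times the left-hand side is part of the
   expansion of [w i * \prod_(i' in B) (1 + x * w i')], taken at [x = m / k]. *)
Lemma subset_weight_le (R : realType) (I : finType) (w : I -> R) (B : {set I})
    (i : I) (m : nat) (k : R) :
  (0 < m)%N -> 0 < k -> (forall i', 0 <= w i') -> \sum_(i' in B) w i' <= k ->
  \sum_(Q : {set I} | [&& i \in Q, Q \subset B & #|Q| == m.+1])
     \prod_(i' in Q) w i' <= w i * (expR 1 * k / m%:R) ^+ m.
Proof.
move=> m0 k0 w0 wB; pose x := m%:R / k.
have mR : 0 < m%:R :> R by rewrite ltr0n.
have x0 : 0 < x by rewrite divr_gt0.
have -> : expR 1 * k / m%:R = expR 1 / x.
  by rewrite /x invf_div mulrA.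
rewrite expr_div_n -expRM_natr mul1r mulrA ler_pdivlMr ?exprn_gt0 //.
(* In the expansion of the product of [F + G], [F] is chosen on [Q] and [G] off [Q]. [G i = 0]
   forces [i] into [Q], and [F] vanishes outside [B] and [i]. *)
pose F i' := if i' == i then w i else if i' \in B then x * w i' else 0.
pose G i' : R := if i' == i then 0 else 1.
have F0 i' : 0 <= F i'.
  by rewrite /F; do 2?case: ifP => _ //; rewrite mulr_ge0 // ltW.
have G0 i' : 0 <= G i' by rewrite /G; case: ifP.
have le_prod : \prod_i' (F i' + G i') <= w i * expR m%:R.
  rewrite (bigD1 i) //= {1}/F {1}/G eqxx addr0; apply: ler_wpM2l => //.
  have le1 i' : i' != i -> 0 <= F i' + G i' <= expR (if i' \in B then x * w i' else 0).
    move=> ne; rewrite addr_ge0 //= /F /G (negbTE ne) addrC; exact: expR_ge1Dx.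
  apply: (@le_trans _ _ (\prod_(i' | i' != i) expR (if i' \in B then x * w i' else 0))).
    exact: ler_prod.
  rewrite -expR_sum ler_expR.
  apply: (@le_trans _ _ (\sum_i' (if i' \in B then x * w i' else 0))).
    rewrite [X in _ <= X](bigD1 i) //= lerDr; case: ifP => // _.
    by rewrite mulr_ge0 // ltW.
  rewrite -big_mkcond -mulr_sumr /= /x mulrAC ler_pdivrMr // ler_wpM2l //.
apply: le_trans le_prod; rewrite bigA_distr.
rewrite [X in _ <= X](bigID (fun Q : {set I} => [&& i \in Q, Q \subset B & #|Q| == m.+1])) /=.
rewrite -[X in X <= _]addr0; apply: lerD; last first.
  by apply: sumr_ge0 => Q _; apply: prodr_ge0 => i' _; case: ifP.
rewrite mulr_suml; apply: ler_sum => Q /and3P[iQ QB /eqP sQ].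
rewrite (bigD1 i) //= [X in _ <= X](bigD1 i) //= iQ {1}/F eqxx -mulrA.
apply: ler_wpM2l => //.
have -> : x ^+ m = \prod_(i' in Q | i' != i) x.
  rewrite prodr_const; congr (_ ^+ _).
  have := cardsD1 i Q; rewrite iQ sQ add1n => -[->].
  by apply: eq_card => i'; rewrite !inE andbC.
rewrite mulrC -big_split /= big_mkcondr [X in _ <= X]big_mkcond /=.
rewrite big_mkcond; apply: ler_prod => i' _.
case: (eqVneq i' i) => [_|ne] /=; first by case: ifP; rewrite ler01 lexx.
case: ifP => i'Q; last by rewrite /G (negbTE ne) ler01 lexx.
by rewrite /F (negbTE ne) (subsetP QB) // lexx mulr_ge0 // ltW.
Qed.

(** Each edge is charged to a pair (member, component) whose left end is common to the edge. The
    edges charged to one pair consist of members through that left end, of total weight at most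
    [k]. *)
Lemma edge_weight_le (R : realType) (I : finType) (N s m : nat)
    (J : I -> 'I_s -> {set 'I_N}) (A : I -> {set 'I_N}) (w : I -> R) (k : R)
    (x0 : 'I_N) (E : {set {set I}}) :
  (forall i, A i = \bigcup_j J i j) -> (forall i j, ord_convex (J i j)) ->
  (0 < m)%N -> 0 < k -> (forall i, 0 <= w i) ->
  (forall x, \sum_(i | x \in A i) w i <= k) ->
  (forall Q, Q \in E ->
     #|Q| = m.+1 /\ exists x, forall i, i \in Q -> x \in A i) ->
  \sum_(Q in E) \prod_(i in Q) w i
    <= s%:R * (expR 1 * k / m%:R) ^+ m * \sum_i w i.
Proof.
move=> AJ Jc m0 k0 w0 depth EP.
have [l lP] := left_ends J x0.
pose B x := [set i | x \in A i].
have weight0 Q : 0 <= \prod_(i in Q) w i by apply: prodr_ge0.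
apply: (@le_trans _ _ (\sum_(ij : I * 'I_s) \sum_(Q : {set I} |
   [&& ij.1 \in Q, Q \subset B (l ij.1 ij.2) & #|Q| == m.+1])
     \prod_(i in Q) w i)).
  rewrite (exchange_big_dep predT) //= big_mkcond; apply: ler_sum => Q _.
  case: ifP => [QE|_]; last by apply: sumr_ge0.
  have [sQ [x xQ]] := EP _ QE.
  have /set0Pn[i0 i0Q] : Q != set0 by rewrite -card_gt0 sQ.
  have [|i [j [iQ lQ]]] := common_left_end Jc lP i0Q (x := x).
    by move=> i /xQ; rewrite AJ.
  rewrite (bigD1 (i, j)) /=; first by rewrite lerDl sumr_ge0.
  rewrite iQ sQ eqxx andbT; apply/subsetP => i' /lQ.
  by rewrite inE AJ.
apply: (@le_trans _ _ (\sum_(ij : I * 'I_s) w ij.1 * (expR 1 * k / m%:R) ^+ m)).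
  apply: ler_sum => -[i j] _ /=; apply: subset_weight_le => //.
  by rewrite /B; under eq_bigl do rewrite inE.
rewrite -(pair_bigA _ (fun i (j : 'I_s) => w i * (expR 1 * k / m%:R) ^+ m)) /=.
rewrite mulr_sumr; apply: ler_sum => i _.
rewrite sumr_const card_ord; set c := _ ^+ m.
by have -> : w i * c *+ s = s%:R * c * w i by ring.
Qed.

(** * The fractional estimate and piercing all but [4 * p] members *)

Lemma deep_point (R : realType) (I : finType) (N s m p : nat)
    (J : I -> 'I_s -> {set 'I_N}) (A : I -> {set 'I_N}) (w : I -> R) (k : R)
    (x0 : 'I_N) :
  (forall i, A i = \bigcup_j J i j) -> (forall i j, ord_convex (J i j)) ->
  abstract_pq A p m.+1 -> (0 < m)%N -> 0 < k ->
  2 * s%:R * (expR 1 * k / m%:R) ^+ m <= 1 ->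
  (forall i, 0 <= w i <= 1) -> \sum_i w i = 2 * p%:R ->
  exists x, k < \sum_(i | x \in A i) w i.
Proof.
move=> AJ Jc [_ pq] m0 k0 small w01 sw.
apply/existsP; apply: contraT; rewrite negb_exists => /forallP depth.
pose E := [set Q : {set I} | (#|Q| == m.+1) &&
             [exists x, [forall (i | i \in Q), x \in A i]]].
have EP Q : Q \in E -> #|Q| = m.+1 /\ exists x, forall i, i \in Q -> x \in A i.
  rewrite inE => /andP[/eqP -> /existsP[x /forall_inP xQ]]; split=> //.
  by exists x.
have wE := @edge_weight_le R I N s m J A w k x0 E AJ Jc m0 k0.
have [|S hS] := @exists_sample R I w E p w01.
  rewrite sw mulr_natl mulr2n lerD2l; apply: le_trans (wE _ _ EP) _.
  - by move=> i; have /andP[] := w01 i.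
  - by move=> x; rewrite leNgt.
  by rewrite sw; move: small (ler0n R p); nra.
have [|S' sS' noE] := delete_edges _ hS; first by rewrite inE cards0.
have [Q [QS sQ] [x xQ]] := pq _ sS'.
suff QE : Q \in E by have := noE _ QE; rewrite QS.
by rewrite inE sQ eqxx; apply/existsP; exists x; apply/forall_inP.
Qed.

(** If the deficits [H - h i] total less than [2 * p * H], few members can have deficit at least
    [H / 2]. Otherwise, rescaled to total [2 * p], they are weights at most 1, and a deep point for
    them contradicts the balance of [t]; [#|I| < H] absorbs the error term. *)
Lemma few_missed (R : realType) (I : finType) (N s m p T H : nat)
    (J : I -> 'I_s -> {set 'I_N}) (A : I -> {set 'I_N}) (k : R) (x0 : 'I_N) :
  (forall i, A i = \bigcup_j J i j) -> (forall i j, ord_convex (J i j)) ->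
  abstract_pq A p m.+1 -> (0 < p)%N -> (0 < m)%N -> 0 < k ->
  2 * s%:R * (expR 1 * k / m%:R) ^+ m <= 1 ->
  (#|I| < H)%N -> 4 * p%:R * H%:R <= T%:R * k ->
  exists t : {ffun 'I_T -> 'I_N},
    (#|[set i | 2 * hits A t i <= H]| <= 4 * p)%N.
Proof.
move=> AJ Jc pq p0 m0 k0 small nH Tk.
have [t tP] := balanced_tuple T H A x0; exists t.
set h := hits A t in tP *; pose W := (\sum_i (H - h i))%N.
have H0 : (0 < H)%N by apply: leq_trans nH.
have [W_small|W_large] := ltnP W (2 * p * H).
  rewrite -(leq_pmul2r H0) -sum_nat_const big_mkcond /=.
  apply: (@leq_trans (2 * W)); last by lia.
  rewrite big_distrr; apply: leq_sum => i _; rewrite inE /=.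
  by case: ifP => //; lia.
exfalso.
have W0 : 0 < W%:R :> R by rewrite ltr0n; apply: leq_trans W_large; rewrite !muln_gt0 p0.
have p0R : 0 < p%:R :> R by rewrite ltr0n.
have H0R : 0 < H%:R :> R by rewrite ltr0n.
have W_largeR : 2 * p%:R * H%:R <= W%:R :> R.
  by rewrite -[2]/(2%:R) -!natrM ler_nat.
pose w i : R := (H - h i)%:R * (2 * p%:R / W%:R).
have [||x] := @deep_point R I N s m p J A w k x0 AJ Jc pq m0 k0 small.
- move=> i; rewrite /w mulr_ge0 ?divr_ge0 ?mulr_ge0 //= mulrA ler_pdivrMr // mul1r.
  apply: le_trans W_largeR; rewrite mulrC ler_wpM2l ?mulr_ge0 // ler_nat.
  exact: leq_subr.
- by rewrite /w -mulr_suml -natr_sum -/W mulrC divfK // gt_eqF.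
rewrite /w -mulr_suml -natr_sum; set D := (\sum_(_ | _) _)%N => kD.
have TD : T%:R * D%:R <= H%:R * W%:R + #|I|%:R * H%:R :> R.
  by rewrite -!natrM -natrD ler_nat; apply: tP.
have kWD : k * W%:R < D%:R * (2 * p%:R).
  by move: kD; rewrite [_ * (_ / _)]mulrA ltr_pdivlMr.
have TnH : #|I|%:R < H%:R :> R by rewrite ltr_nat.
have T0 : 0 <= T%:R :> R by [].
have p1 : 1 <= p%:R :> R by rewrite ler1n.
have : 4 * p%:R * H%:R * W%:R <= T%:R * (D%:R * (2 * p%:R)) :> R.
  apply: (@le_trans _ _ (T%:R * k * W%:R)).
    by apply: ler_wpM2r => //; apply: ltW.
  rewrite -mulrA.
  by apply: ler_wpM2l => //; apply: ltW.
have : T%:R * D%:R * (2 * p%:R) <= (H%:R * W%:R + #|I|%:R * H%:R) * (2 * p%:R) :> R.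
  by apply: ler_wpM2r => //; rewrite mulr_ge0.
have : (p%:R * H%:R) * #|I|%:R < (p%:R * H%:R) * W%:R :> R.
  rewrite ltr_pM2l ?mulr_gt0 //; apply: lt_le_trans TnH _.
  apply: le_trans W_largeR; rewrite ler_peMl //; lra.
lra.
Qed.

Lemma pierce_most (R : realType) (I : finType) (N s m p : nat)
    (J : I -> 'I_s -> {set 'I_N}) (A : I -> {set 'I_N}) (k : R) (x0 : 'I_N) :
  (forall i, A i = \bigcup_j J i j) -> (forall i j, ord_convex (J i j)) ->
  abstract_pq A p m.+1 -> (0 < s)%N -> (0 < p)%N -> (0 < m)%N -> 0 < k ->
  2 * s%:R * (expR 1 * k / m%:R) ^+ m <= 1 ->
  exists (P : {set 'I_N}) (B : {set I}),
    [/\ #|P|%:R <= 8 * p%:R * s%:R / k + 1, (#|B| <= 4 * p)%N &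
        forall i, i \notin B -> pierces A P i].
Proof.
move=> AJ Jc pq s0 p0 m0 k0 small.
(* Half of [H] is [s * M], the threshold for a net of spacing [M]. With [T] about [4 * p * H / k],
   the net has about [8 * p * s / k] points; rounding [T] up adds at most 1. *)
pose M := #|I|.+1; pose H := (2 * s * M)%N.
pose v : R := 4 * p%:R * H%:R / k; pose T := (Num.truncn v).+1.
have v0 : 0 <= v by rewrite divr_ge0 ?mulr_ge0 // ltW.
have [t tP] : exists t : {ffun 'I_T -> 'I_N},
    (#|[set i | 2 * hits A t i <= H]| <= 4 * p)%N.
  apply: (@few_missed R I N s m p T H J A k x0) => //.
    by rewrite /H /M; nia.
  by rewrite -ler_pdivrMr // ltW // truncnS_gt.
have [P sP PP] := @net_of_tuple I T N s M J A t (ltn0Sn _) AJ Jc.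
exists P, [set i | 2 * hits A t i <= H]%N; split=> //.
  have M1 : 1 <= M%:R :> R by rewrite ler1n.
  have : (#|P| * M)%:R <= T%:R :> R.
    by rewrite ler_nat; apply: leq_trans (leq_trunc_div T M); rewrite leq_mul2r sP orbT.
  have Tv : T%:R <= v + 1 by rewrite /T -natr1 lerD2r truncn_le.
  have vE : v = 8 * p%:R * s%:R / k * M%:R.
    by rewrite /v /H !natrM; ring.
  have u0 : 0 <= 8 * p%:R * s%:R / k by rewrite divr_ge0 ?mulr_ge0 // ltW.
  move: u0 vE; set u := 8 * p%:R * s%:R / k => u0 vE.
  rewrite natrM => h; rewrite -(ler_pM2r (lt_le_trans ltr01 M1)).
  by apply: le_trans h _; rewrite mulrDl mul1r -vE; apply: le_trans Tv _; rewrite lerD2l.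
by move=> i; rewrite inE -ltnNge /H => hi; apply: PP; lia.
Qed.

(** * Piercing the exceptional members *)

Lemma pierces_sub (I : finType) (N : nat) (A : I -> {set 'I_N})
    (P P' : {set 'I_N}) (i : I) :
  P \subset P' -> pierces A P i -> pierces A P' i.
Proof.
move=> PP' /pred0Pn[x /= /andP[xP xA]].
by apply/pred0Pn; exists x; rewrite /= (subsetP PP') ?xA.
Qed.

Lemma pierce_singly (I : finType) (N : nat) (A : I -> {set 'I_N})
    (B : {set I}) : (forall i, A i != set0) ->
  exists2 P : {set 'I_N}, (#|P| <= #|B|)%N & forall i, i \in B -> pierces A P i.
Proof.
move=> A0; have [i0 i0B|B0] := pickP (mem B); last first.
  by exists set0; rewrite ?cards0 // => i; have := B0 i => /= ->.
have /set0Pn[x0 x0A] := A0 i0.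
pose pt i := odflt x0 [pick y in A i].
exists (pt @: B); first exact: leq_imset_card.
move=> i iB; apply/pred0Pn; exists (pt i); rewrite /= imset_f //= /pt.
case: pickP => // e; case/set0Pn: (A0 i) => y.
by have := e y => /= ->.
Qed.

(** Greedy choice: each selected point removes at least [q] members of [B]. *)
Lemma deplete_deep_points (I : finType) (N q : nat) (A : I -> {set 'I_N})
    (B : {set I}) : (0 < q)%N ->
  exists (P : {set 'I_N}) (B' : {set I}),
    [/\ B' \subset B, (#|P| * q <= #|B|)%N,
        forall i, i \in B :\: B' -> pierces A P i &
        forall x, (#|[set i in B' | x \in A i]| < q)%N].
Proof.
move=> q0; have [n] := ubnP #|B|; elim: n B => // n IH B sB.
case: (boolP [exists x, q <= #|[set i in B | x \in A i]|])%N => [/existsP[x xq]|].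
  pose D := [set i in B | x \in A i].
  have sDB : D \subset B by apply/subsetP => i; rewrite inE => /andP[].
  have cD : (#|B :\: D| + #|D| = #|B|)%N.
    by rewrite -(cardsID D B) (setIidPr sDB) addnC.
  have [|P [B' [B'B sP PP small]]] := IH (B :\: D); first by rewrite -/D in xq; lia.
  exists (x |: P), B'; split=> //.
  - exact: subset_trans B'B (subsetDl _ _).
  - rewrite cardsU1 mulnDl -cD addnC leq_add //; rewrite -/D in xq.
    by case: (x \notin P); rewrite ?mul1n ?mul0n.
  move=> i; rewrite inE => /andP[iB' iB]; case: (boolP (i \in D)) => [|iD].
    rewrite inE => /andP[_ xA]; apply/pred0Pn.
    by exists x; rewrite /= setU11.
  by apply: pierces_sub (subsetUr _ _) (PP i _); rewrite in_setD iB' in_setD iD.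
rewrite negb_exists => /forallP small.
exists set0, B; split=> //; first by rewrite cards0.
  by move=> i; rewrite setDv inE.
by move=> x; rewrite ltnNge.
Qed.

Lemma pierce_shallow (I : finType) (N p q : nat) (A : I -> {set 'I_N})
    (B : {set I}) :
  abstract_pq A p q -> (q <= p)%N -> (forall i, A i != set0) ->
  (forall x, (#|[set i in B | x \in A i]| < q)%N) ->
  exists2 P : {set 'I_N}, (#|P| <= p - q + 1)%N &
    forall i, i \in B -> pierces A P i.
Proof.
move=> [pI pq] qp A0 small.
have [i0 i0B|B0] := pickP (mem B); last first.
  by exists set0; rewrite ?cards0 // => i; have := B0 i => /= ->.
have /set0Pn[x0 x0A] := A0 i0.
pose D x := [set i in B | x \in A i].
pose x := [arg max_(x > x0) #|D x|]; have xmax y : (#|D y| <= #|D x|)%N.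
  by rewrite /x; case: arg_maxnP => // z _; apply.
have sDB : D x \subset B by apply/subsetP => i; rewrite inE => /andP[].
have cD : (#|B :\: D x| + #|D x| = #|B|)%N.
  by rewrite -(cardsID (D x) B) (setIidPr sDB) addnC.
have cB : (#|B| <= p - q + #|D x|)%N.
  (* [S] is [B] filled up to [p] members, or [p] members of [B] if there are that many. Of the [q]
     intersecting ones at most [p - #|B|] lie outside [B] and at most [#|D x|] inside; since
     [#|D x| < q], the second case cannot occur. *)
  have cBC : (#|B| + #|~: B| = #|I|)%N by apply: cardsC.
  have [S SB sS] : exists2 S : {set I},
      (#|S :\: B| <= p - #|B|)%N & #|S| = p.
    have [pB|Bp] := leqP p #|B|.
      have /card_geqP[s [us ss sB]] : (p <= #|B|)%N by [].
      have e : [set i in s] :\: B = set0.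
        by apply/eqP; rewrite setD_eq0; apply/subsetP => i; rewrite inE => /sB.
      exists [set i in s]; first by rewrite e cards0.
      by rewrite cardsE -ss; apply/card_uniqP.
    have /card_geqP[s [us ss sB]] : (p - #|B| <= #|~: B|)%N by lia.
    have e : [set i in s] :&: B = set0.
      apply/setP => i; rewrite !inE; apply/negP => /andP[/sB].
      by rewrite inE => /negP.
    have cs : #|[set i in s]| = (p - #|B|)%N by rewrite cardsE -ss; apply/card_uniqP.
    exists (B :|: [set i in s]).
      rewrite setDUl setDv set0U -cs; exact/subset_leq_card/subsetDl.
    by rewrite cardsU setIC e cards0 subn0 cs subnKC // ltnW.
  have [Q [QS sQ] [y yQ]] := pq _ sS.
  have QBD : (#|Q :&: B| <= #|D x|)%N.
    apply: leq_trans (xmax y); apply/subset_leq_card/subsetP => i.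
    by rewrite !inE => /andP[/yQ -> ->].
  have QD : (#|Q :\: B| <= #|S :\: B|)%N by apply/subset_leq_card/setSD.
  have := cardsID B Q; have := small x; rewrite -/(D x) => h1 h2.
  lia.
have [P sP PP] := pierce_singly (B :\: D x) A0.
exists (x |: P).
  rewrite cardsU1; apply: leq_trans (leq_add (leq_b1 _) sP) _.
  by rewrite addnC leq_add2r -(leq_add2r #|D x|) cD.
move=> i iB; case: (boolP (i \in D x)) => iD.
  apply/pred0Pn; exists x; rewrite /= setU11.
  by move: iD; rewrite inE => /andP[].
by apply: pierces_sub (subsetUr _ _) (PP i _); rewrite in_setD iD.
Qed.

(** * The two transversal bounds with [k] free *)

Lemma transversal_linear (R : realType) (I : finType) (N s m p : nat)
    (J : I -> 'I_s -> {set 'I_N}) (A : I -> {set 'I_N}) (k : R) (x0 : 'I_N) :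
  (forall i, A i = \bigcup_j J i j) -> (forall i j, ord_convex (J i j)) ->
  (forall i, A i != set0) ->
  abstract_pq A p m.+1 -> (0 < s)%N -> (0 < p)%N -> (0 < m)%N -> 0 < k ->
  2 * s%:R * (expR 1 * k / m%:R) ^+ m <= 1 ->
  exists2 P : {set 'I_N}, forall i, pierces A P i &
    #|P|%:R <= 4 * p%:R + (8 * p%:R * s%:R / k + 1).
Proof.
move=> AJ Jc A0 pq s0 p0 m0 k0 small.
have [P1 [B [sP1 sB PP1]]] := pierce_most x0 AJ Jc pq s0 p0 m0 k0 small.
have [P2 sP2 PP2] := pierce_singly B A0.
exists (P1 :|: P2) => [i|].
  case: (boolP (i \in B)) => [/PP2|/PP1]; apply: pierces_sub.
    exact: subsetUr.
  exact: subsetUl.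
apply: (@le_trans _ _ (#|P2|%:R + #|P1|%:R)).
  by rewrite -natrD ler_nat addnC leq_card_setU.
apply: lerD => //; rewrite -natrM ler_nat; exact: leq_trans sP2 sB.
Qed.

Lemma transversal_sharp (R : realType) (I : finType) (N s m p : nat)
    (J : I -> 'I_s -> {set 'I_N}) (A : I -> {set 'I_N}) (k : R) (x0 : 'I_N) :
  (forall i, A i = \bigcup_j J i j) -> (forall i j, ord_convex (J i j)) ->
  (forall i, A i != set0) ->
  abstract_pq A p m.+1 -> (m < p)%N -> (0 < s)%N -> (0 < m)%N -> 0 < k ->
  2 * s%:R * (expR 1 * k / m%:R) ^+ m <= 1 ->
  exists2 P : {set 'I_N}, forall i, pierces A P i &
    #|P|%:R <= p%:R - m.+1%:R + 1 + 4 * p%:R / m.+1%:R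
               + (8 * p%:R * s%:R / k + 1).
Proof.
move=> AJ Jc A0 pq mp s0 m0 k0 small; have p0 : (0 < p)%N by lia.
have [P1 [B [sP1 sB PP1]]] := pierce_most x0 AJ Jc pq s0 p0 m0 k0 small.
have [P2 [B' [B'B sP2 PP2 shallow]]] := deplete_deep_points A B (ltn0Sn m).
have [P3 sP3 PP3] := pierce_shallow pq mp A0 shallow.
exists (P3 :|: P2 :|: P1) => [i|].
  case: (boolP (i \in B)) => [iB|/PP1]; last by apply: pierces_sub; apply: subsetUr.
  case: (boolP (i \in B')) => [/PP3|iB'].
    by apply: pierces_sub; rewrite -setUA subsetUl.
  apply: (@pierces_sub _ _ _ P2); last by apply: PP2; rewrite in_setD iB' iB.
  by apply: subset_trans (subsetUl _ _); apply: subsetUr.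
apply: (@le_trans _ _ (#|P3|%:R + #|P2|%:R + #|P1|%:R)).
  rewrite -!natrD ler_nat; apply: leq_trans (leq_card_setU _ _) _.
  by rewrite leq_add2r leq_card_setU.
apply: lerD => //; apply: lerD.
  by rewrite -natrB // natr1 ler_nat -addn1.
rewrite ler_pdivlMr ?ltr0n // -!natrM ler_nat; exact: leq_trans sP2 sB.
Qed.

(* From the real line to the finite model *)
From mathcomp Require Import all_classical all_reals all_analysis.
Local Open Scope classical_set_scope.

Lemma s_convex_components (R : realType) (s : nat) (D : set R) :
  s_convex s D -> exists J : 'I_s -> set R,
    (forall j, is_interval (J j)) /\ D = \bigcup_(j in setT) J j.
Proof.
move=> [t ts [J JI ->]].
(* Missing components are padded with empty sets to reach exactly [s]. *)
exists (fun j => if insub (j : nat) is Some j' then J j' else set0); split.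
  by move=> j; case: insubP => [j' _ _|_] //; apply: JI.
apply/seteqP; split=> x [j _ Jx].
  exists (widen_ord ts j) => //=.
  by case: insubP => [j' _ /= /val_inj ->|/negP[]] //=.
by case: insubP Jx => // j' _ _ Jx; exists j'.
Qed.

(* Only the witnesses of the finitely many common intersections matter; listing
   them in increasing order turns the family into one over ['I_N]. *)
Lemma discretize (R : realType) (s : nat) (F : {fset set R}) :
  (forall D, D \in F -> D !=set0 /\ s_convex s D) ->
  exists (N : nat) (_ : 'I_N) (pt : 'I_N -> R) (J : F -> 'I_s -> {set 'I_N}),
    [/\ forall i j, ord_convex (J i j),
        forall i j x, x \in J i j -> fsval i (pt x) &
        forall (Q : {set F}) (r : R), (forall i, i \in Q -> fsval i r) ->
          exists x, forall i, i \in Q -> exists j, x \in J i j].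
Proof.
move=> FP.
have /choice[Jr JrP] : forall i : F, exists J : 'I_s -> set R,
    (forall j, is_interval (J j)) /\ fsval i = \bigcup_(j in setT) J j.
  by move=> i; apply: s_convex_components; have [] := FP _ (fsvalP i).
(* One witness per subfamily, with default 0 when the subfamily has no common point. *)
pose w (Q : {set F}) : R := xget 0 [set r | forall i, i \in Q -> fsval i r].
pose ws := sort <=%R [seq w Q | Q : {set F}].
have wsP Q : w Q \in ws by rewrite mem_sort; apply/map_f; rewrite mem_enum.
have ws_le a b : (a <= b)%N -> (b < size ws)%N -> nth 0 ws a <= nth 0 ws b.
  move=> ab bs; apply: (sorted_leq_nth le_trans lexx) => //.
    by apply: sort_sorted; apply: le_total.
  by rewrite inE; apply: leq_ltn_trans bs.
have ws0 : (0 < size ws)%N by rewrite -has_predT; apply/hasP; exists (w finset.set0).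
exists (size ws), (Ordinal ws0), (fun x : 'I_(size ws) => nth 0 ws x).
exists (fun i j => [set x : 'I_(size ws) | `[< Jr i j (nth 0 ws x) >]]%SET); split.
- move=> i j a b c; rewrite !finset.in_set => /asboolP Ja /asboolP Jc ab bc.
  apply/asboolP; apply: (proj1 (JrP i) j _ _ Ja Jc).
  by rewrite !ws_le.
- move=> i j x; rewrite finset.in_set => /asboolP Jx.
  by rewrite (proj2 (JrP i)); exists j.
move=> Q r rQ; have wQ : forall i, i \in Q -> fsval i (w Q).
  exact: (@xgetPex _ 0 [set r | forall i, i \in Q -> fsval i r] (ex_intro _ r rQ)).
have iw : (index (w Q) ws < size ws)%N by rewrite index_mem.
exists (Ordinal iw) => i /wQ; rewrite (proj2 (JrP i)) => -[j _ Jw].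
by exists j; rewrite finset.in_set /= nth_index //; apply/asboolP.
Qed.

(** Real common points yield discrete ones, which transfers the [(p, q)]-property. Conversely [pt]
    maps a discrete piercing set to a real one that is no larger. *)
Lemma discretize_pq (R : realType) (s p q : nat) (F : {fset set R}) :
  (forall D, D \in F -> D !=set0 /\ s_convex s D) -> pq_property p q F ->
  exists (N : nat) (_ : 'I_N) (J : F -> 'I_s -> {set 'I_N})
    (A : F -> {set 'I_N}),
    [/\ forall i, A i = (\bigcup_j J i j)%SET, forall i j, ord_convex (J i j),
        forall i, A i != finset.set0, abstract_pq A p q &
        forall P : {set 'I_N}, (forall i, pierces A P i) -> (tau F <= #|P|)%N].
Proof.
move=> FP [pF pq]; have [N [x0 [pt [J [Jc Jpt JQ]]]]] := discretize FP.
pose A i := (\bigcup_j J i j)%SET.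
have Apt i x : x \in A i -> fsval i (pt x) by move=> /bigcupP[j _ /Jpt].
have AQ (Q : {set F}) r : (forall i, i \in Q -> fsval i r) ->
    exists x, forall i, i \in Q -> x \in A i.
  move=> /JQ[x xQ]; exists x => i /xQ[j xJ]; apply/bigcupP; by exists j.
exists N, x0, J, A; split=> //.
- move=> i; have [[r ir] _] := FP _ (fsvalP i).
  have [|x xA] := AQ (finset.set1 i) r; first by move=> i'; rewrite inE => /eqP ->.
  by apply/set0Pn; exists x; apply: xA; rewrite inE.
- split; first by rewrite -cardfE.
  move=> S sS; pose G := [fset fsval i | i in S]%fset.
  have [||H [HG sH [r rH]]] := pq G.
  + by apply/fsubsetP => D /imfsetP[i _ ->]; apply: fsvalP.
  + by rewrite card_imfset //=; [rewrite -sS -cardE|apply: val_inj].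
  have HS D : D \in H -> exists2 i, i \in S & D = fsval i.
    by move=> /(fsubsetP HG)/imfsetP[i iS ->]; exists i.
  exists [set i | fsval i \in H]%SET; [split|].
  + apply/fintype.subsetP => i; rewrite inE => /HS[i' i'S /val_inj ->] //.
  + have HQ : H = [fset fsval i | i in [set i : F | fsval i \in H]%SET]%fset :> {fset set R}.
      apply/fsetP => D; apply/idP/imfsetP => [DH|[i /=]]; last by rewrite inE => iH ->.
      by have [i iS e] := HS _ DH; exists i; rewrite //= inE -e.
    by rewrite -sH [in RHS]HQ card_imfset //= -?cardE //; apply: val_inj.
  apply: (AQ _ r) => i; rewrite inE; exact: rH.
move=> P PA; pose P' := [fset pt x | x in P]%fset.
have F0 D : D \in F -> D !=set0 by move=> /FP[].
have [_ tmin] := tauP F0.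
apply: (@leq_trans #|` P'|); last by rewrite (leq_trans (leq_imfset_card _ _ _)) //= -cardE.
apply: tmin; exists P' => // D DF.
have /pred0Pn[x /= /andP[xP /Apt xA]] := PA [` DF]%fset.
by exists (pt x); split=> //; apply/imfsetP; exists x.
Qed.

(** As [tau F] is an integer, the truncation of [b] is itself a bound, so a least one exists below
    it. *)
Lemma is_HD_le (R : realType) (s p q : nat) (b : R) : 0 <= b ->
  (forall F : {fset set R}, (forall D, D \in F -> D !=set0 /\ s_convex s D) ->
     pq_property p q F -> (tau F)%:R <= b) ->
  exists2 N, is_HD R s p q N & N%:R <= b.
Proof.
move=> b0 hb; have bound : HD_bound R s p q (Num.truncn b).
  by move=> F FP pqF; rewrite truncn_ge_nat //; apply: hb.
have [N [NP Nmin]] : exists N, is_least [set M | HD_bound R s p q M] N.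
  by apply: is_least_ex; exists (Num.truncn b).
by exists N => //; rewrite -truncn_ge_nat //; apply: Nmin.
Qed.


(** * Choice of [k] and the constants *)

Theorem theorem1p5 (R : realType) :
  exists C K : R,
    [/\ 0 < C, 0 < K,
      forall p q s : nat, (q <= p)%N -> (2 <= q)%N -> (1 <= s)%N ->
        exists2 N : nat, is_HD R s p q N &
          N%:R <= K * p%:R * s%:R `^ (q%:R / (q%:R - 1)) &
      forall p q s : nat, (q < p)%N -> (2 <= q)%N -> (1 <= s)%N ->
        C * ln (expR 1 * s%:R * p%:R) <= q%:R ->
        exists2 N : nat, is_HD R s p q N &
          N%:R <= p%:R - q%:R + 1
                  + K * s%:R * (p%:R / q%:R) * ln (expR 1 * s%:R * p%:R / q%:R)].
Proof.
pose e : R := expR 1; have e1 : 1 <= e by rewrite -expR0 ler_expR ler01.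
have e0 : 0 < e := expR_gt0 _.
have K0 : 0 < 16 * e ^+ 2 + 5 by have := sqr_ge0 e; lra.
(* In both parts [16 * e ^+ 2] pays for [8 * p * s / k], and 5 for the remaining terms [4 * p + 1]
   or [4 * p / q + 1]. From here on [q] is [m.+1]. *)
exists 1, (16 * e ^+ 2 + 5); split=> // p [|m] s // mp m0 s0.
  have mR : 1 <= m%:R :> R by rewrite ler1n.
  have sR : 1 <= s%:R :> R by rewrite ler1n.
  have pR : 1 <= p%:R :> R by rewrite ler1n; lia.
  pose a : R := s%:R `^ m%:R^-1.
  have a1 : 1 <= a by rewrite /a -[X in X <= _](powRr0 s%:R); apply: ler_powR; rewrite ?invr_ge0.
  have am : a ^+ m = s%:R.
    by rewrite -powR_mulrn ?powR_ge0 // -powRrM mulVf ?powRr1 // pnatr_eq0; lia.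
  have -> : s%:R `^ (m.+1%:R / (m.+1%:R - 1)) = s%:R * a.
    have -> : m.+1%:R / (m.+1%:R - 1) = 1 + m%:R^-1 :> R.
      by rewrite -natr1 addrK; field; lra.
    by rewrite powRD ?powRr1 // implybE gt_eqF ?orbT //; lra.
  have sa1 : 1 <= s%:R * a by apply: mulr_ege1.
  have K1 : 0 <= (16 * e ^+ 2 + 5) * p%:R * (s%:R * a).
    by rewrite !mulr_ge0 ?ltW //; lra.
  apply: is_HD_le => // F FP pqF.
  have [N [x0 [J [A [AJ Jc A0 pqA tauP]]]]] := discretize_pq FP pqF.
  (* Then [e * k / m] is the inverse of [2 * a], whose [m]-th power is [2 ^+ m * s], at least
     [2 * s]. *)
  pose k : R := m%:R / (2 * e * a).
  have k0 : 0 < k by rewrite divr_gt0 ?mulr_gt0 //; lra.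
  have [||P PA sP] := transversal_linear x0 AJ Jc A0 pqA s0 _ m0 k0.
  - by lia.
  - have -> : expR 1 * k / m%:R = (2 * a)^-1.
      by rewrite /k -/e; field; rewrite !gt_eqF //; lra.
    rewrite exprVn exprMn am ler_pdivrMr ?mul1r; last first.
      by rewrite mulr_gt0 ?exprn_gt0 //; lra.
    by rewrite ler_wpM2r // ?(le_trans ler01) // ler_eXnr //; lra.
  apply: (@le_trans _ _ #|P|%:R); first by rewrite ler_nat tauP.
  apply: le_trans sP _.
  have kE : 8 * p%:R * s%:R / k = 16 * e * (p%:R * (s%:R * a)) / m%:R.
    by rewrite /k; field; rewrite !gt_eqF //; lra.
  have psa : p%:R <= p%:R * (s%:R * a) by rewrite ler_peMr.
  set u := p%:R * (s%:R * a) in kE psa.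
  have u1 : 1 <= u by apply: le_trans psa.
  have : 8 * p%:R * s%:R / k <= 16 * e * u.
    by rewrite kE ler_pdivrMr ?(lt_le_trans ltr01) // ler_peMr // !mulr_ge0 //; lra.
  have : e * u <= e ^+ 2 * u.
    by rewrite expr2 ler_pM2r ?ler_peMl //; lra.
  have -> : (16 * e ^+ 2 + 5) * p%:R * (s%:R * a) = 16 * (e ^+ 2 * u) + 5 * u.
    by rewrite /u; ring.
  by lra.
rewrite mul1r => logq.
have mR : 1 <= m%:R :> R by rewrite ler1n.
have sR : 1 <= s%:R :> R by rewrite ler1n.
have pR : 2 <= p%:R :> R by rewrite -[2]/(2%:R) ler_nat; lia.
have qR : 0 < m.+1%:R :> R by rewrite ltr0n.
have qp : m.+1%:R <= p%:R :> R by rewrite ler_nat ltnW.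
have sp0 : 0 < s%:R * p%:R :> R by rewrite mulr_gt0 //; lra.
(* Exponentiating [logq] gives [e * s * p <= e ^+ m.+1]; one factor [e] cancels and [2 <= p]. *)
have expm : 2 * s%:R <= e ^+ m.
  have : e * s%:R * p%:R <= e ^+ m.+1.
    have esp0 : 0 < e * s%:R * p%:R by rewrite -mulrA mulr_gt0.
    by rewrite -[X in X <= _]lnK ?posrE // /e -expRM_natr mul1r ler_expR.
  rewrite exprS -mulrA ler_pM2l //; apply: le_trans.
  by rewrite mulrC ler_pM2l //; lra.
pose v : R := s%:R * (p%:R / m.+1%:R).
have v1 : 1 <= v.
  by apply: mulr_ege1 => //; rewrite ler_pdivlMr // mul1r.
(* The logarithm equals [1 + ln v] with [v >= 1], so a bound by a multiple of [v] suffices. *)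
have L1 : 1 <= ln (expR 1 * s%:R * p%:R / m.+1%:R) :> R.
  rewrite [X in ln X](_ : _ = expR 1 * v); last by rewrite /v !mulrA.
  rewrite lnM ?posrE ?expR_gt0 ?(lt_le_trans ltr01) // expRK lerDl.
  exact: ln_ge0.
set L := ln _ in L1 *.
have -> : (16 * e ^+ 2 + 5) * s%:R * (p%:R / m.+1%:R) * L
    = (16 * e ^+ 2 + 5) * (v * L) by rewrite /v; ring.
have vL : v <= v * L by rewrite ler_peMr //; lra.
have KvL : (16 * e ^+ 2 + 5) * v <= (16 * e ^+ 2 + 5) * (v * L) by rewrite ler_pM2l.
apply: is_HD_le => [|F FP pqF].
  by have : 0 <= (16 * e ^+ 2 + 5) * v; [rewrite mulr_ge0 //; lra | lra].
have [N [x0 [J [A [AJ Jc A0 pqA tauP]]]]] := discretize_pq FP pqF.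
(* Now [e * k / m] is the inverse of [e], and the smallness condition becomes [expm]. *)
pose k : R := m%:R / e ^+ 2.
have k0 : 0 < k by rewrite divr_gt0 ?exprn_gt0 //; lra.
have [|P PA sP] := transversal_sharp x0 AJ Jc A0 pqA (ltnW mp) s0 m0 k0.
  have -> : expR 1 * k / m%:R = e^-1.
    by rewrite /k -/e; field; rewrite !gt_eqF //; lra.
  by rewrite exprVn ler_pdivrMr ?mul1r ?exprn_gt0.
apply: (@le_trans _ _ #|P|%:R); first by rewrite ler_nat tauP.
apply: le_trans sP _.
have kE : 8 * p%:R * s%:R / k = 8 * e ^+ 2 * (v * (m.+1%:R / m%:R)).
  by rewrite /k /v; field; rewrite !gt_eqF //; lra.
have : 8 * p%:R * s%:R / k <= 16 * (e ^+ 2 * v).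
  rewrite kE; have -> : 16 * (e ^+ 2 * v) = 8 * e ^+ 2 * (v * 2) by ring.
  have mm : m.+1%:R / m%:R <= 2 :> R by rewrite -natr1 ler_pdivrMr; lra.
  by rewrite ler_pM2l ?mulr_gt0 ?exprn_gt0 // ler_pM2l // (lt_le_trans ltr01).
have : p%:R / m.+1%:R <= v :> R.
  by rewrite /v ler_peMl // divr_ge0.
rewrite -[4 * p%:R / _]mulrA.
have KvE : (16 * e ^+ 2 + 5) * v = 16 * (e ^+ 2 * v) + 5 * v by ring.
move: KvL; rewrite KvE; move: (p%:R - m.+1%:R + 1) (_ * (v * L)) (e ^+ 2 * v).
by move: (8 * _ * _ / k) (p%:R / _ : R) => y0 y1 y2 y3 y4; lra.
Qed.
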